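(* Let $\beta>0$, $\omega>0$ and $\alpha\in[0,3/2]$. The unique solution $t\in[0,\infty)\mapsto(u(t),v(t))$ of the system $$u'=v,\qquad v'=1-\frac{\beta}{\sqrt{\omega}}\,v-\sqrt{2u}$$ with initial data $(u(0),v(0))=(\alpha^2/2,0)$ converges to the unique critical point $(u_{\mathrm{cr}},v_{\mathrm{cr}})=(1/2,0)$ as $t\to\infty$.
   Context: The prime denotes differentiation with respect to the independent variable $t$. The system is considered on $\{(u,v)\in\mathbb{R}^2:u\ge0,\ v\in\mathbb{R}\}$, so solutions satisfy $u(t)\ge0$ for all $t\geq 0$. The system is the first-order form of $u''+\frac{\beta}{\sqrt{\omega}}u'+\sqrt{2u}=1$, $u(0)=\alpha^2/2$, $u'(0)=0$. *)

(* Defs.v *)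
From Stdlib Require Import Reals.
From Coquelicot Require Import Coquelicot.
Open Scope R_scope.

(* [sqrt] is 0 on negative reals, so the domain u >= 0 of the system is
   imposed explicitly in the definitions that use this field. *)
Definition vector_field (beta omega : R) (p : R * R) : R * R :=
  (snd p, 1 - beta / sqrt omega * snd p - sqrt (2 * fst p)).

Definition critical_point (beta omega : R) (p : R * R) : Prop :=
  0 <= fst p /\ vector_field beta omega p = (0, 0).

(* A solution on [0, oo): the values of u and v at negative times are
   irrelevant, and the derivatives are taken within [0, oo), hence from the
   right at t = 0. *)
Definition is_solution (beta omega : R) (p0 : R * R) (u v : R -> R) : Prop :=
  (u 0, v 0) = p0 /\
  forall t : R, 0 <= t ->
    0 <= u t /\
    D_in u (fun s => fst (vector_field beta omega (u s, v s)))
      (fun s => 0 <= s) t /\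
    D_in v (fun s => snd (vector_field beta omega (u s, v s)))
      (fun s => 0 <= s) t.

(* Main.v *)
Require Import Defs.
From Corelib Require Import ssreflect.
From Stdlib Require Import Reals Lra Lia.
From Coquelicot Require Import Coquelicot.
Open Scope R_scope.

(** Write [k = beta / sqrt omega].  Along a solution the energy
    [E = v ^ 2 / 2 + sqrt (2 * u) ^ 3 / 3 - u] has derivative [- k * v ^ 2], and
    initially [E = alpha ^ 2 * (2 * alpha - 3) / 6 <= 0] for
    [0 <= alpha <= 3 / 2].  After any short time [E] is negative, say [- eta]
    ([early_energy]), and [E <= - eta] forces [u >= eta]
    ([le_position_of_energy]): the solution never returns to the degenerate
    point [u = 0], where the square root is not Lipschitz.

    For [alpha = 0] the solution starts at that point, but leaves it like
    [t ^ 2 / 2].  Every solution therefore satisfies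
    [sqrt (2 * u t) >= min(t, d) / 2] for some [d > 0] ([solves_above_floor]).
    Replacing the square root by its maximum with this floor ([trunc]) gives a
    nonlinearity whose Lipschitz constant in [u] is [2 / min(t, d)].  This
    singularity is harmless because two solutions with the same initial data
    and velocities differing by at most [D * exp (lam * t)] have positions
    differing by at most [D * min(t, d) * exp (lam * t)], if [lam >= 1 / d]: in a
    suitable exponentially weighted norm the Picard map is a contraction on all of [[0, oo)]
    ([picard_contraction]).  This yields global existence and uniqueness for the
    truncated system, and the energy shows that for small [d] the solution
    never falls below the floor ([solves_exists]).

    For the limit, a small multiple of [v * (u - 1 / 2)] is added to [E + 1 / 6].
    Since [E <= 0] gives [sqrt (2 * u) <= 3 / 2], the sum is comparable to
    [(u - 1 / 2) ^ 2 + v ^ 2] and decays exponentially ([lyapunov_bounds],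
    [lyapunov_dissipation]). *)

(** * Comparison of derivatives and induction on an interval *)

Lemma nonincreasing_on (a b : R) (f f' : R -> R) :
  a <= b ->
  (forall t, a <= t <= b -> is_derive f t (f' t)) ->
  (forall t, a < t < b -> f' t <= 0) ->
  f b <= f a.
Proof.
intros Hab Hd Hneg.
destruct (Req_dec a b) as [->|Hne]; [lra|].
destruct (MVT_cor2 f f' a b) as [c [Hc Hc']]; [lra| |].
- intros t Ht; apply is_derive_Reals; now apply Hd.
- assert (f' c <= 0) by (apply Hneg; lra). nra.
Qed.

Lemma Rabs_le_of_derive (T : R) (f f' G G' : R -> R) :
  (forall t, 0 <= t <= T -> is_derive f t (f' t)) ->
  (forall t, 0 <= t <= T -> is_derive G t (G' t)) ->
  (forall t, 0 < t < T -> Rabs (f' t) <= G' t) ->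
  Rabs (f 0) <= G 0 ->
  forall t, 0 <= t <= T -> Rabs (f t) <= G t.
Proof.
intros Hf HG Hle H0 t Ht.
assert (H1 : f t - G t <= f 0 - G 0).
{ apply (nonincreasing_on 0 t (fun s => f s - G s) (fun s => f' s - G' s)).
  - lra.
  - intros s Hs; apply (is_derive_minus f G); [apply Hf|apply HG]; lra.
  - intros s Hs; generalize (Hle s ltac:(lra)) (Rle_abs (f' s)); lra. }
assert (H2 : - f t - G t <= - f 0 - G 0).
{ apply (nonincreasing_on 0 t (fun s => - f s - G s) (fun s => - f' s - G' s)).
  - lra.
  - intros s Hs; apply (is_derive_minus (fun x => - f x) G).
    + apply (is_derive_opp f); apply Hf; lra.
    + apply HG; lra.
  - intros s Hs; generalize (Hle s ltac:(lra)) (Rle_abs (- f' s)).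
    rewrite Rabs_Ropp; lra. }
generalize (Rle_abs (f 0)) (Rle_abs (- f 0)); rewrite Rabs_Ropp => H3 H4.
apply Rabs_le; lra.
Qed.

Lemma continuous_eps (f : R -> R) (t eps : R) :
  continuous f t -> 0 < eps ->
  exists del, 0 < del /\ forall s, Rabs (s - t) < del -> Rabs (f s - f t) < eps.
Proof.
intros Hc Heps.
destruct (proj1 (filterlim_locally _ _) Hc (mkposreal _ Heps)) as [del Hdel].
exists del; split; [apply cond_pos|].
intros s Hs; exact (Hdel s Hs).
Qed.

(** Continuous induction: if [f] can nowhere descend to the value [m] while being
    above it before, then [f] stays above [m]. *)
Lemma interval_induction (a b m : R) (f : R -> R) :
  (forall t, a <= t <= b -> continuous f t) ->
  (forall t, a <= t <= b -> (forall s, a <= s < t -> m < f s) -> m <= f t ->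
     m < f t) ->
  m < f a ->
  forall t, a <= t <= b -> m < f t.
Proof.
intros Hc Hstep Ha.
destruct (Rle_dec a b) as [Hab|Hab]; [|intros; lra].
set (A := fun t => a <= t <= b /\ forall s, a <= s <= t -> m < f s).
assert (HAa : A a).
{ split; [lra|]; intros s Hs; replace s with a by lra; exact Ha. }
destruct (completeness A) as [S [Sub Slub]].
{ exists b; intros t [Ht _]; lra. }
{ exists a; exact HAa. }
assert (HaS : a <= S) by (apply Sub; exact HAa).
assert (HSb : S <= b) by (apply Slub; intros t [Ht _]; lra).
assert (Hbelow : forall s, a <= s < S -> m < f s).
{ intros s Hs.
  destruct (Rlt_dec m (f s)) as [H|H]; [exact H|exfalso].
  assert (S <= s); [|lra].
  apply Slub; intros t [Ht Hft].
  destruct (Rle_dec t s) as [H'|H']; [exact H'|].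
  exfalso; apply H, Hft; lra. }
assert (HSm : m <= f S).
{ destruct (Rle_dec m (f S)) as [H|H]; [exact H|exfalso].
  destruct (continuous_eps f S (m - f S)) as [del [Hdel Hs]]; [apply Hc; lra|lra|].
  assert (a < S).
  { destruct (Req_dec a S) as [E|E]; [rewrite <- E in H; lra|lra]. }
  set (s := Rmax a (S - del / 2)).
  assert (Hs1 : a <= s < S).
  { unfold s; split; [apply Rmax_l|apply Rmax_lub_lt; lra]. }
  assert (Hs2 : S - del / 2 <= s) by apply Rmax_r.
  assert (H1 : Rabs (f s - f S) < m - f S).
  { apply Hs; apply Rabs_def1; lra. }
  apply Rabs_def2 in H1.
  generalize (Hbelow s Hs1); lra. }
assert (HSm' : m < f S) by (apply Hstep; [lra|exact Hbelow|exact HSm]).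
assert (HSeq : S = b).
{ destruct (Req_dec S b) as [E|E]; [exact E|exfalso].
  destruct (continuous_eps f S (f S - m)) as [del [Hdel Hs]]; [apply Hc; lra|lra|].
  set (t := Rmin b (S + del / 2)).
  assert (Ht1 : S < t <= b).
  { unfold t; split; [apply Rmin_glb_lt; lra|apply Rmin_l]. }
  assert (Ht2 : t <= S + del / 2) by apply Rmin_r.
  assert (t <= S); [|lra].
  apply Sub; split; [lra|].
  intros s Hs1.
  destruct (Rlt_dec s S) as [H|H]; [apply Hbelow; lra|].
  assert (H1 : Rabs (f s - f S) < f S - m) by (apply Hs; apply Rabs_def1; lra).
  apply Rabs_def2 in H1; lra. }
intros t Ht; destruct (Req_dec t S) as [->|E]; [exact HSm'|apply Hbelow; lra].
Qed.

(** * The truncated nonlinearity *)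

(** The square root [sqrt (2 * x)], replaced by [min(t, d) / 2] where it is
    smaller.  The floor vanishes at [t = 0], so that the solution leaving the
    degenerate point [u = 0], which behaves like [t ^ 2 / 2], stays above it. *)
Definition trunc (d t x : R) : R := Rmax (sqrt (2 * x)) (Rmin t d / 2).

Lemma Rmax_sqrt_diff_le (b x y : R) : 0 < b -> y <= x ->
  0 <= (Rmax (sqrt (2 * x)) b - Rmax (sqrt (2 * y)) b) /\
  (Rmax (sqrt (2 * x)) b - Rmax (sqrt (2 * y)) b) * b <= x - y.
Proof.
intros Hb Hyx.
assert (Hs : sqrt (2 * y) <= sqrt (2 * x)) by (apply sqrt_le_1_alt; lra).
set (r := Rmax (sqrt (2 * y)) b).
assert (Hr1 : sqrt (2 * y) <= r) by apply Rmax_l.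
assert (Hr2 : b <= r) by apply Rmax_r.
assert (Hry : 2 * y <= r * r).
{ destruct (Rle_dec 0 y) as [Hy|Hy].
  - generalize (sqrt_sqrt (2 * y) ltac:(lra)) (sqrt_pos (2 * y)); nra.
  - nra. }
destruct (Rle_dec (sqrt (2 * x)) b) as [H|H].
- rewrite (Rmax_right (sqrt (2 * x))); [|lra].
  unfold r; rewrite Rmax_right; lra.
- rewrite (Rmax_left (sqrt (2 * x))); [|lra].
  assert (Hx : 0 < 2 * x).
  { destruct (Rlt_dec 0 (2 * x)) as [Hx|Hx]; [exact Hx|].
    rewrite sqrt_neg_0 in H; lra. }
  assert (r <= sqrt (2 * x)) by (apply Rmax_lub; lra).
  generalize (sqrt_sqrt (2 * x) ltac:(lra)); split; nra.
Qed.

(** Above the floor the square root is Lipschitz, with a constant that blows up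
    only like [1 / t] as [t] tends to [0]. *)
Lemma trunc_lipschitz (d t x y : R) : 0 < d -> 0 < t ->
  Rabs (trunc d t x - trunc d t y) * Rmin t d <= 2 * Rabs (x - y).
Proof.
intros Hd Ht; unfold trunc.
assert (Hm : 0 < Rmin t d) by (apply Rmin_glb_lt; lra).
destruct (Rle_dec y x) as [H|H].
- destruct (Rmax_sqrt_diff_le (Rmin t d / 2) x y) as [H1 H2]; [lra|lra|].
  rewrite (Rabs_pos_eq (_ - _)); [|exact H1].
  rewrite (Rabs_pos_eq (x - y)); lra.
- destruct (Rmax_sqrt_diff_le (Rmin t d / 2) y x) as [H1 H2]; [lra|lra|].
  rewrite Rabs_minus_sym (Rabs_minus_sym x).
  rewrite (Rabs_pos_eq (_ - _)); [|exact H1].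
  rewrite (Rabs_pos_eq (y - x)); lra.
Qed.

Lemma continuous_Rmax (f g : R -> R) (t : R) :
  continuous f t -> continuous g t -> continuous (fun s => Rmax (f s) (g s)) t.
Proof.
intros Hf Hg.
apply (continuous_ext (fun s => (f s + g s + Rabs (f s - g s)) / 2)).
{ intros s; unfold Rmax, Rabs; destruct Rle_dec; destruct Rcase_abs; lra. }
apply (continuous_mult (fun s => f s + g s + Rabs (f s - g s)) (fun _ => / 2)).
2: apply continuous_const.
apply (continuous_plus (fun s => f s + g s) (fun s => Rabs (f s - g s))).
- now apply (continuous_plus f g).
- apply (continuous_comp (fun s => f s - g s) Rabs).
  + now apply (continuous_minus f g).
  + apply continuous_Rabs.
Qed.

Lemma continuous_trunc (d t : R) (u : R -> R) : continuous u t ->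
  continuous (fun s => trunc d s (u s)) t.
Proof.
intros Hu; unfold trunc.
apply continuous_Rmax.
- apply (continuous_comp (fun s => 2 * u s) sqrt).
  + apply (continuous_mult (fun _ => 2) u); [apply continuous_const|exact Hu].
  + apply continuous_sqrt.
- apply (continuous_ext (fun s => - Rmax (- s) (- d) / 2)).
  { intros s; unfold Rmax, Rmin; do 2 destruct Rle_dec; lra. }
  apply (continuous_mult (fun s => - Rmax (- s) (- d)) (fun _ => / 2)).
  2: apply continuous_const.
  apply (continuous_opp (V := R_NormedModule) (fun s : R => Rmax (- s) (- d))).
  apply (continuous_Rmax (fun s => - s) (fun _ => - d)).
  + apply (continuous_opp (V := R_NormedModule) (fun s : R => s)); apply continuous_id.
  + apply continuous_const.
Qed.

(** * Existence and uniqueness for the truncated system *)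

Lemma is_derive_scaled_exp (A lam t : R) :
  is_derive (fun s => A * exp (lam * s)) t (A * (lam * exp (lam * t))).
Proof. auto_derive; [exact I|ring]. Qed.

(** The Picard map contracts the weighted norm [sup exp (- lam * t) * |z t|] by
    a factor [1 / 2]: [z] and [y] are the differences of two inputs and of the
    corresponding outputs.  The singular Lipschitz constant [2 / min(t, d)] is
    absorbed by the bound [|w t| <= D * min(t, d) * exp (lam * t)]. *)
Lemma picard_contraction (k d lam T D : R) (z w y h : R -> R) :
  0 < k -> 0 < d -> / d <= lam -> 2 * (k + 2) <= lam ->
  (forall t, 0 <= t <= T -> is_derive w t (z t)) ->
  (forall t, 0 <= t <= T -> is_derive y t (- k * z t - h t)) ->
  w 0 = 0 -> y 0 = 0 ->
  (forall t, 0 < t <= T -> Rabs (h t) * Rmin t d <= 2 * Rabs (w t)) ->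
  (forall t, 0 <= t <= T -> Rabs (z t) <= D * exp (lam * t)) ->
  forall t, 0 <= t <= T -> Rabs (y t) <= D / 2 * exp (lam * t).
Proof.
intros Hk Hd Hlam1 Hlam2 Hw Hy Hw0 Hy0 Hh Hz t0 Ht0.
assert (HD : 0 <= D).
{ generalize (Hz 0 ltac:(lra)) (Rabs_pos (z 0)).
  rewrite Rmult_0_r exp_0; lra. }
assert (Hld : 1 <= lam * d).
{ apply (Rmult_le_compat_r d) in Hlam1; [|lra].
  rewrite Rinv_l in Hlam1; lra. }
assert (Hw1 : forall t, 0 <= t <= T -> Rabs (w t) <= D * t * exp (lam * t)).
{ apply (Rabs_le_of_derive T w z (fun t => D * t * exp (lam * t))
    (fun t => D * exp (lam * t) * (1 + lam * t))); [exact Hw| | |].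
  - intros t Ht; auto_derive; [exact I|ring].
  - intros t Ht; eapply Rle_trans; [apply Hz; lra|].
    assert (0 <= D * exp (lam * t))
      by (generalize (exp_pos (lam * t)); intros; nra).
    assert (0 <= lam * t) by nra. nra.
  - rewrite Hw0 Rabs_R0; lra. }
assert (Hw2 : forall t, 0 <= t <= T -> Rabs (w t) <= D * d * exp (lam * t)).
{ apply (Rabs_le_of_derive T w z (fun t => D * d * exp (lam * t))
    (fun t => D * d * (lam * exp (lam * t)))); [exact Hw| | |].
  - intros t Ht; apply is_derive_scaled_exp.
  - intros t Ht; eapply Rle_trans; [apply Hz; lra|].
    assert (0 <= D * exp (lam * t))
      by (generalize (exp_pos (lam * t)); intros; nra).
    nra.
  - rewrite Hw0 Rabs_R0 Rmult_0_r exp_0; nra. }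
assert (Hh' : forall t, 0 < t <= T -> Rabs (h t) <= 2 * D * exp (lam * t)).
{ intros t Ht.
  assert (Hm : 0 < Rmin t d) by (apply Rmin_glb_lt; lra).
  apply (Rmult_le_reg_r (Rmin t d)); [exact Hm|].
  eapply Rle_trans; [now apply Hh|].
  unfold Rmin; destruct Rle_dec.
  - generalize (Hw1 t ltac:(lra)); lra.
  - generalize (Hw2 t ltac:(lra)); lra. }
revert t0 Ht0.
apply (Rabs_le_of_derive T y (fun t => - k * z t - h t)
  (fun t => D / 2 * exp (lam * t)) (fun t => D / 2 * (lam * exp (lam * t)))).
- exact Hy.
- intros t Ht; apply is_derive_scaled_exp.
- intros t Ht.
  eapply Rle_trans; [apply Rabs_triang|].
  rewrite Rabs_Ropp Rabs_mult Rabs_Ropp (Rabs_pos_eq k); [|lra].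
  generalize (Hz t ltac:(lra)) (Hh' t ltac:(lra)); intros H1 H2.
  assert (0 <= D * exp (lam * t))
    by (generalize (exp_pos (lam * t)); intros; nra).
  nra.
- rewrite Hy0 Rabs_R0 Rmult_0_r exp_0; lra.
Qed.

(** [(u, v)] solves [u' = v], [v' = 1 - k v - g t u] on [[0, T]], with two-sided
    derivatives at the endpoints. *)
Definition solves (k : R) (g : R -> R -> R) (T : R) (u v : R -> R) : Prop :=
  forall t, 0 <= t <= T ->
    is_derive u t (v t) /\ is_derive v t (1 - k * v t - g t (u t)).

Lemma eq_0_of_le_half_pow (x A : R) :
  (forall n : nat, Rabs x <= A * (1 / 2) ^ n) -> x = 0.
Proof.
intros H.
apply Rabs_eq_0, Rle_antisym; [|apply Rabs_pos].
assert (L : is_lim_seq (fun n => A * (1 / 2) ^ n) (A * 0)).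
{ apply (is_lim_seq_scal_l (fun n => (1 / 2) ^ n) A 0).
  apply is_lim_seq_geom; rewrite Rabs_pos_eq; lra. }
rewrite Rmult_0_r in L.
exact (is_lim_seq_le (fun _ => Rabs x) _ (Rabs x) 0 H (is_lim_seq_const _) L).
Qed.

Lemma solves_trunc_unique (k d T : R) (u1 v1 u2 v2 : R -> R) :
  0 < k -> 0 < d ->
  solves k (trunc d) T u1 v1 -> solves k (trunc d) T u2 v2 ->
  u1 0 = u2 0 -> v1 0 = v2 0 ->
  forall t, 0 <= t <= T -> u1 t = u2 t /\ v1 t = v2 t.
Proof.
intros Hk Hd H1 H2 Hu0 Hv0 t0 Ht0.
assert (HT : 0 <= T) by lra.
set (lam := Rmax (/ d) (2 * (k + 2))).
assert (Hl1 : / d <= lam) by apply Rmax_l.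
assert (Hl2 : 2 * (k + 2) <= lam) by apply Rmax_r.
assert (Dw : forall t, 0 <= t <= T ->
  is_derive (fun s => u1 s - u2 s) t (v1 t - v2 t)).
{ intros t Ht; apply (is_derive_minus u1 u2); [apply H1|apply H2]; lra. }
assert (Dy : forall t, 0 <= t <= T ->
  is_derive (fun s => v1 s - v2 s) t
    (- k * (v1 t - v2 t) - (trunc d t (u1 t) - trunc d t (u2 t)))).
{ intros t Ht.
  replace (- k * _ - _) with
    ((1 - k * v1 t - trunc d t (u1 t)) - (1 - k * v2 t - trunc d t (u2 t)))
    by ring.
  apply (is_derive_minus v1 v2); [apply H1|apply H2]; lra. }
destruct (continuity_ab_maj (fun s => Rabs (v1 s - v2 s)) 0 T HT) as [m [Hm _]].
{ intros s Hs; apply continuity_pt_filterlim.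
  apply (continuous_comp (fun x => v1 x - v2 x) Rabs).
  - apply (ex_derive_continuous (fun x => v1 x - v2 x)).
    eexists; apply (Dy s Hs).
  - apply continuous_Rabs. }
set (D := Rabs (v1 m - v2 m)) in *.
assert (HD : 0 <= D) by apply Rabs_pos.
assert (Hn : forall n t, 0 <= t <= T ->
  Rabs (v1 t - v2 t) <= D * (1 / 2) ^ n * exp (lam * t)).
{ induction n as [|n IH].
  - intros t Ht; rewrite /= Rmult_1_r.
    eapply Rle_trans; [now apply Hm|].
    assert (1 <= exp (lam * t)).
    { eapply Rle_trans; [|apply exp_ineq1_le].
      assert (0 <= lam * t) by nra. lra. }
    nra.
  - replace (D * (1 / 2) ^ S n) with (D * (1 / 2) ^ n / 2) by (simpl; field).
    apply (picard_contraction k d lam T (D * (1 / 2) ^ n)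
      (fun s => v1 s - v2 s) (fun s => u1 s - u2 s) (fun s => v1 s - v2 s)
      (fun s => trunc d s (u1 s) - trunc d s (u2 s))); auto; try lra.
    intros t Ht; apply trunc_lipschitz; lra. }
assert (Hv : forall t, 0 <= t <= T -> v1 t - v2 t = 0).
{ intros t Ht; apply (eq_0_of_le_half_pow _ (D * exp (lam * t))); intros n.
  eapply Rle_trans; [now apply (Hn n)|]. apply Req_le; ring. }
split; [|generalize (Hv t0 Ht0); lra].
assert (Rabs (u1 t0 - u2 t0) <= 0).
{ apply (Rabs_le_of_derive T (fun s => u1 s - u2 s) (fun s => v1 s - v2 s)
    (fun _ => 0) (fun _ => 0)); auto.
  - intros t Ht; apply (@is_derive_const R_AbsRing R_NormedModule).
  - intros t Ht; rewrite Hv ?Rabs_R0; lra.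
  - replace (u1 0 - u2 0) with 0 by lra; rewrite Rabs_R0; lra. }
assert (u1 t0 - u2 t0 = 0); [|lra].
apply Rabs_eq_0, Rle_antisym; [assumption|apply Rabs_pos].
Qed.

Lemma is_derive_RInt_0 (f : R -> R) (c t : R) : (forall s, continuous f s) ->
  is_derive (fun x => c + RInt f 0 x) t (f t).
Proof.
intros Hf.
replace (f t) with (0 + f t) by ring.
apply (is_derive_plus (fun _ => c) (fun x => RInt f 0 x)).
- apply (@is_derive_const R_AbsRing R_NormedModule).
- apply (is_derive_RInt f (RInt f 0) 0 t); [|apply Hf].
  exists (mkposreal 1 Rlt_0_1); intros x _.
  apply (RInt_correct f), ex_RInt_continuous; intros; apply Hf.
Qed.

(** First component of the Picard map: the antiderivative of [v]. *)
Definition position (u0 : R) (v : R -> R) (t : R) : R := u0 + RInt v 0 t.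

(** Second component of the Picard map: the antiderivative of the right-hand
    side of the equation for the velocity. *)
Definition velocity (k d u0 : R) (v : R -> R) (t : R) : R :=
  0 + RInt (fun s => 1 - k * v s - trunc d s (position u0 v s)) 0 t.

Lemma position_0 (u0 : R) (v : R -> R) : position u0 v 0 = u0.
Proof. unfold position; rewrite RInt_point; apply Rplus_0_r. Qed.

Lemma velocity_0 (k d u0 : R) (v : R -> R) : velocity k d u0 v 0 = 0.
Proof. unfold velocity; rewrite RInt_point; apply Rplus_0_r. Qed.

Lemma is_derive_position (u0 : R) (v : R -> R) (t : R) :
  (forall s, continuous v s) -> is_derive (position u0 v) t (v t).
Proof. intros Hv; now apply is_derive_RInt_0. Qed.

Lemma is_derive_velocity (k d u0 : R) (v : R -> R) (t : R) :
  (forall s, continuous v s) ->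
  is_derive (velocity k d u0 v) t (1 - k * v t - trunc d t (position u0 v t)).
Proof.
intros Hv.
apply (is_derive_RInt_0 (fun s => 1 - k * v s - trunc d s (position u0 v s))).
intros s.
apply (continuous_minus (fun s => 1 - k * v s)
  (fun s => trunc d s (position u0 v s))).
- apply (continuous_minus (fun _ => 1) (fun s => k * v s)).
  + apply continuous_const.
  + apply (continuous_mult (fun _ => k) v); [apply continuous_const|apply Hv].
- apply continuous_trunc, (ex_derive_continuous (position u0 v)).
  eexists; now apply is_derive_position.
Qed.

Lemma continuous_velocity (k d u0 : R) (v : R -> R) (t : R) :
  (forall s, continuous v s) -> continuous (velocity k d u0 v) t.
Proof.
intros Hv; apply (ex_derive_continuous (velocity k d u0 v)).
eexists; now apply is_derive_velocity.
Qed.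

Lemma velocity_contraction (k d u0 lam D : R) (v1 v2 : R -> R) :
  0 < k -> 0 < d -> / d <= lam -> 2 * (k + 2) <= lam ->
  (forall s, continuous v1 s) -> (forall s, continuous v2 s) ->
  (forall t, 0 <= t -> Rabs (v1 t - v2 t) <= D * exp (lam * t)) ->
  forall t, 0 <= t ->
    Rabs (velocity k d u0 v1 t - velocity k d u0 v2 t) <= D / 2 * exp (lam * t).
Proof.
intros Hk Hd Hl1 Hl2 Hc1 Hc2 H t Ht.
apply (picard_contraction k d lam t D (fun s => v1 s - v2 s)
  (fun s => position u0 v1 s - position u0 v2 s)
  (fun s => velocity k d u0 v1 s - velocity k d u0 v2 s)
  (fun s => trunc d s (position u0 v1 s) - trunc d s (position u0 v2 s)));
  try assumption.
- intros s _; apply (is_derive_minus (position u0 v1) (position u0 v2));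
    now apply is_derive_position.
- intros s _.
  replace (- k * (v1 s - v2 s) - _) with
    ((1 - k * v1 s - trunc d s (position u0 v1 s)) -
     (1 - k * v2 s - trunc d s (position u0 v2 s))) by ring.
  apply (is_derive_minus (velocity k d u0 v1) (velocity k d u0 v2));
    now apply is_derive_velocity.
- rewrite !position_0; ring.
- rewrite !velocity_0; ring.
- intros s Hs; apply trunc_lipschitz; lra.
- intros s Hs; apply H; lra.
- lra.
Qed.

(** The velocities of the successive approximations, from the constant [0]. *)
Fixpoint picard (k d u0 : R) (n : nat) : R -> R :=
  match n with
  | O => fun _ => 0
  | S n => velocity k d u0 (picard k d u0 n)
  end.

Lemma continuous_picard (k d u0 : R) (n : nat) (t : R) :
  continuous (picard k d u0 n) t.
Proof.
revert t; induction n as [|n IH]; intros t; simpl.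
- apply continuous_const.
- now apply continuous_velocity.
Qed.

Lemma picard_step (k d u0 lam : R) :
  0 < k -> 0 < d -> / d <= lam -> 2 * (k + 2) <= lam ->
  exists D, 0 <= D /\ forall n t, 0 <= t ->
    Rabs (picard k d u0 (S n) t - picard k d u0 n t)
      <= D * (1 / 2) ^ n * exp (lam * t).
Proof.
intros Hk Hd Hl1 Hl2.
set (K := 1 + sqrt (2 * u0) + d).
assert (HK : 0 <= K) by (unfold K; generalize (sqrt_pos (2 * u0)); lra).
exists (K / lam); split.
{ apply Rmult_le_pos; [lra|]; apply Rlt_le, Rinv_0_lt_compat; lra. }
induction n as [|n IH]; intros t Ht.
- rewrite Rmult_1_r.
  assert (Hz : forall s, continuous (fun _ : R => 0) s)
    by (intros; apply continuous_const).
  apply (Rabs_le_of_derive t (fun s => picard k d u0 1 s - picard k d u0 0 s)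
    (fun s => 1 - k * 0 - trunc d s (position u0 (fun _ => 0) s))
    (fun s => K / lam * exp (lam * s))
    (fun s => K / lam * (lam * exp (lam * s)))).
  + intros s Hs.
    apply (is_derive_ext (velocity k d u0 (fun _ => 0)));
      [intros; simpl; ring|].
    now apply is_derive_velocity.
  + intros s Hs; apply is_derive_scaled_exp.
  + intros s Hs.
    replace (position u0 (fun _ => 0) s) with u0
      by (unfold position; rewrite RInt_const /scal /= /mult /=; ring).
    replace (K / lam * (lam * exp (lam * s))) with (K * exp (lam * s))
      by (field; lra).
    apply Rle_trans with (K * 1).
    * unfold trunc, K.
      generalize (Rmin_r s d) (Rmin_glb_lt s d 0 ltac:(lra) ltac:(lra))
        (sqrt_pos (2 * u0)); intros.
      unfold Rmax; destruct Rle_dec; apply Rabs_le; lra.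
    * apply Rmult_le_compat_l; [exact HK|].
      eapply Rle_trans; [|apply exp_ineq1_le].
      assert (0 <= lam * s) by nra. lra.
  + simpl picard; rewrite velocity_0 Rminus_0_r Rabs_R0 Rmult_0_r exp_0.
    assert (0 < / lam) by (apply Rinv_0_lt_compat; lra).
    unfold Rdiv; nra.
  + lra.
- replace (K / lam * (1 / 2) ^ S n) with (K / lam * (1 / 2) ^ n / 2)
    by (simpl; field; lra).
  change (Rabs (velocity k d u0 (picard k d u0 (S n)) t -
    velocity k d u0 (picard k d u0 n) t)
    <= K / lam * (1 / 2) ^ n / 2 * exp (lam * t)).
  apply velocity_contraction; auto; intros; apply continuous_picard.
Qed.

Lemma picard_cauchy (k d u0 lam D : R) :
  (forall n t, 0 <= t ->
    Rabs (picard k d u0 (S n) t - picard k d u0 n t)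
      <= D * (1 / 2) ^ n * exp (lam * t)) ->
  forall n p t, 0 <= t ->
    Rabs (picard k d u0 (n + p) t - picard k d u0 n t)
      <= 2 * D * ((1 / 2) ^ n - (1 / 2) ^ (n + p)) * exp (lam * t).
Proof.
intros H n p t Ht; induction p as [|p IH].
- rewrite Nat.add_0_r !Rminus_diag Rabs_R0; lra.
- rewrite Nat.add_succ_r.
  replace (_ - picard k d u0 n t) with
    ((picard k d u0 (S (n + p)) t - picard k d u0 (n + p) t) +
     (picard k d u0 (n + p) t - picard k d u0 n t)) by ring.
  eapply Rle_trans; [apply Rabs_triang|].
  generalize (H (n + p)%nat t Ht).
  replace ((1 / 2) ^ S (n + p)) with ((1 / 2) ^ (n + p) / 2) by (simpl; field).
  intros; lra.
Qed.

Lemma half_pow_small (A eps : R) : 0 <= A -> 0 < eps ->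
  exists N, forall n, (N <= n)%nat -> A * (1 / 2) ^ n < eps.
Proof.
intros HA Heps.
destruct (pow_lt_1_zero (1 / 2) ltac:(rewrite Rabs_pos_eq; lra) (eps / (A + 1)))
  as [N HN].
{ apply Rdiv_lt_0_compat; lra. }
exists N; intros n Hn; generalize (HN n Hn).
assert (0 < (1 / 2) ^ n) by (apply pow_lt; lra).
rewrite Rabs_pos_eq; [|lra]; intros H1.
apply (Rmult_lt_compat_r (A + 1)) in H1; [|lra].
replace (eps / (A + 1) * (A + 1)) with eps in H1 by (field; lra).
nra.
Qed.

(** The limit of the Picard iterates on [[0, oo)], extended to a continuous
    function on the whole line. *)
Lemma picard_limit (k d u0 lam : R) :
  0 < k -> 0 < d -> / d <= lam -> 2 * (k + 2) <= lam ->
  exists D v, 0 <= D /\ (forall s, continuous v s) /\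
    forall n t, 0 <= t ->
      Rabs (picard k d u0 n t - v t) <= 2 * D * (1 / 2) ^ n * exp (lam * t).
Proof.
intros Hk Hd Hl1 Hl2.
destruct (picard_step k d u0 lam Hk Hd Hl1 Hl2) as [D [HD Hstep]].
generalize (picard_cauchy k d u0 lam D Hstep); intros Hcau.
set (v := fun t => real (Lim_seq (fun n => picard k d u0 n (Rmax 0 t)))).
assert (Hlim : forall t, 0 <= t ->
  is_lim_seq (fun n => picard k d u0 n t) (v t)).
{ intros t Ht; unfold v; rewrite Rmax_right; [|exact Ht].
  apply Lim_seq_correct', ex_lim_seq_cauchy_corr.
  intros eps.
  assert (He : 0 <= 2 * D * exp (lam * t))
    by (generalize (exp_pos (lam * t)); intros; nra).
  destruct (half_pow_small (2 * D * exp (lam * t)) (eps / 2)) as [N HN];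
    [exact He|apply is_pos_div_2|].
  assert (Hbd : forall n, (N <= n)%nat ->
    Rabs (picard k d u0 n t - picard k d u0 N t) < eps / 2).
  { intros n Hn; replace n with (N + (n - N))%nat by lia.
    eapply Rle_lt_trans; [now apply Hcau|].
    eapply Rle_lt_trans; [|apply (HN N); lia].
    assert (0 <= (1 / 2) ^ (N + (n - N))) by (apply pow_le; lra).
    nra. }
  exists N; intros n m Hn Hm.
  replace (_ - _) with ((picard k d u0 n t - picard k d u0 N t) -
    (picard k d u0 m t - picard k d u0 N t)) by ring.
  eapply Rle_lt_trans; [apply Rabs_triang|].
  rewrite Rabs_Ropp.
  generalize (Hbd n Hn) (Hbd m Hm); lra. }
assert (Hrate : forall n t, 0 <= t ->
  Rabs (picard k d u0 n t - v t) <= 2 * D * (1 / 2) ^ n * exp (lam * t)).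
{ intros n t Ht.
  assert (L : is_lim_seq (fun p => Rabs (picard k d u0 n t - picard k d u0 p t))
    (Rabs (picard k d u0 n t - v t))).
  { apply (is_lim_seq_abs _ (picard k d u0 n t - v t)).
    apply is_lim_seq_minus'; [apply is_lim_seq_const|now apply Hlim]. }
  refine (is_lim_seq_le_loc _ _ (Rabs _) _ _ L (is_lim_seq_const _)).
  exists n; intros p Hp; replace p with (n + (p - n))%nat by lia.
  rewrite Rabs_minus_sym.
  eapply Rle_trans; [now apply Hcau|].
  apply Rmult_le_compat_r; [apply Rlt_le, exp_pos|].
  assert (0 <= (1 / 2) ^ (n + (p - n))) by (apply pow_le; lra).
  nra. }
exists D, v; split; [exact HD|split; [|exact Hrate]].
intros x.
apply continuity_pt_filterlim.
apply (CVU_continuity (fun n t => picard k d u0 n (Rmax 0 t)) v x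
  (mkposreal 1 Rlt_0_1)).
- intros eps Heps.
  destruct (half_pow_small (2 * D * exp (lam * (Rabs x + 1))) eps) as [N HN];
    [generalize (exp_pos (lam * (Rabs x + 1))); nra|lra|].
  exists N; intros n y Hn Hy.
  unfold Boule in Hy; simpl in Hy.
  assert (Hy' : 0 <= Rmax 0 y <= Rabs x + 1).
  { split; [apply Rmax_l|apply Rmax_lub].
    - generalize (Rabs_pos x); lra.
    - apply Rabs_def2 in Hy; generalize (Rle_abs x); lra. }
  replace (v y) with (v (Rmax 0 y))
    by (unfold v; rewrite (Rmax_right 0 (Rmax 0 y)); [reflexivity|lra]).
  rewrite Rabs_minus_sym.
  eapply Rle_lt_trans; [apply Hrate; lra|].
  eapply Rle_lt_trans; [|apply (HN n Hn)].
  assert (exp (lam * Rmax 0 y) <= exp (lam * (Rabs x + 1))).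
  { apply Rnot_lt_le; intros H; apply exp_lt_inv in H; nra. }
  assert (0 <= 2 * D * (1 / 2) ^ n)
    by (assert (0 <= (1 / 2) ^ n) by (apply pow_le; lra); nra).
  nra.
- intros n y _; apply continuity_pt_filterlim.
  apply (continuous_comp (fun s => Rmax 0 s) (picard k d u0 n)).
  + apply (continuous_Rmax (fun _ => 0) (fun s => s));
      [apply continuous_const|apply continuous_id].
  + apply continuous_picard.
- unfold Boule; rewrite Rminus_diag Rabs_R0; apply Rlt_0_1.
Qed.

Lemma solves_trunc_exists (k d u0 : R) : 0 < k -> 0 < d ->
  exists u v, u 0 = u0 /\ v 0 = 0 /\ forall T, solves k (trunc d) T u v.
Proof.
intros Hk Hd.
set (lam := Rmax (/ d) (2 * (k + 2))).
assert (Hl1 : / d <= lam) by apply Rmax_l.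
assert (Hl2 : 2 * (k + 2) <= lam) by apply Rmax_r.
destruct (picard_limit k d u0 lam Hk Hd Hl1 Hl2) as [D [v [HD [Hc Hv]]]].
assert (Hfix : forall t, 0 <= t -> velocity k d u0 v t = v t).
{ intros t Ht.
  cut (velocity k d u0 v t - v t = 0); [lra|].
  apply (eq_0_of_le_half_pow _ (2 * D * exp (lam * t))); intros n.
  assert (H1 : Rabs (velocity k d u0 v t - picard k d u0 (S n) t)
    <= 2 * D * (1 / 2) ^ n / 2 * exp (lam * t)).
  { rewrite Rabs_minus_sym; simpl picard.
    apply velocity_contraction; auto; intros; apply continuous_picard. }
  generalize (Hv (S n) t Ht).
  replace ((1 / 2) ^ S n) with ((1 / 2) ^ n / 2) by (simpl; field); intros H2.
  replace (_ - v t) with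
    ((velocity k d u0 v t - picard k d u0 (S n) t) +
     (picard k d u0 (S n) t - v t)) by ring.
  eapply Rle_trans; [apply Rabs_triang|]; lra. }
exists (position u0 v), (velocity k d u0 v).
split; [apply position_0|split; [apply velocity_0|]].
intros T t Ht; rewrite (Hfix t); [|lra]; split.
- now apply is_derive_position.
- now apply is_derive_velocity.
Qed.

(** * The energy *)

(** The nonlinearity of the equation, as a function of time and position. *)
Definition sqrt_field (_ x : R) : R := sqrt (2 * x).

(** The mechanical energy [v ^ 2 / 2 + H u], where [H' u = sqrt (2 * u) - 1];
    the damping dissipates it at the rate [k * v ^ 2]. *)
Definition energy (u v : R) : R := v ^ 2 / 2 + (sqrt (2 * u) ^ 3 / 3 - u).

(** The derivative also exists at [x = 0], where the square root has none. *)
Lemma is_derive_sqrt_cube (x : R) :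
  is_derive (fun y => sqrt (2 * y) ^ 3 / 3) x (sqrt (2 * x)).
Proof.
destruct (Rtotal_order x 0) as [Hx|[->|Hx]].
- rewrite sqrt_neg_0; [|lra].
  apply (is_derive_ext_loc (fun _ => 0)).
  + exists (mkposreal (- x) ltac:(lra)); intros y Hy.
    apply Rabs_def2 in Hy; rewrite /minus /plus /opp /= in Hy.
    rewrite sqrt_neg_0; [|lra].
    change (0 = 0 ^ 3 / 3); field.
  + apply (@is_derive_const R_AbsRing R_NormedModule).
- rewrite Rmult_0_r sqrt_0.
  apply is_derive_Reals; intros eps Heps.
  assert (He : 0 < eps ^ 2 / 2) by nra.
  exists (mkposreal _ He); intros h Hh0 Hh; simpl in Hh.
  apply Rabs_def2 in Hh.
  rewrite Rplus_0_l Rmult_0_r sqrt_0.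
  destruct (Rle_dec h 0) as [H|H].
  + rewrite sqrt_neg_0; [|lra].
    replace ((0 ^ 3 / 3 - 0 ^ 3 / 3) / h - 0) with 0 by (field; lra).
    rewrite Rabs_R0; exact Heps.
  + replace (sqrt (2 * h) ^ 3) with (2 * h * sqrt (2 * h)).
    2:{ rewrite -{1}(sqrt_sqrt (2 * h)); [ring|lra]. }
    replace (_ - 0) with (2 / 3 * sqrt (2 * h)) by (field; lra).
    generalize (sqrt_pos (2 * h)); intros H1.
    rewrite Rabs_pos_eq; [|lra].
    assert (sqrt (2 * h) < eps); [|lra].
    rewrite -(sqrt_pow2 eps); [|lra].
    apply sqrt_lt_1; nra.
- assert (Hs : 0 < sqrt (2 * x)) by (apply sqrt_lt_R0; lra).
  auto_derive; [lra|].
  field; lra.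
Qed.

Lemma is_derive_energy (k T t : R) (u v : R -> R) :
  solves k sqrt_field T u v -> 0 <= t <= T ->
  is_derive (fun s => energy (u s) (v s)) t (- k * v t ^ 2).
Proof.
intros H Ht; destruct (H t Ht) as [Hu Hv]; unfold energy.
replace (- k * v t ^ 2) with
  (v t * (1 - k * v t - sqrt_field t (u t)) + (v t * sqrt (2 * u t) - v t))
  by (unfold sqrt_field; ring).
apply (is_derive_plus (fun s => v s ^ 2 / 2)
  (fun s => sqrt (2 * u s) ^ 3 / 3 - u s)).
- auto_derive; [eexists; exact Hv|].
  rewrite (is_derive_unique _ _ _ Hv); field.
- apply (is_derive_minus (fun s => sqrt (2 * u s) ^ 3 / 3) u); [|exact Hu].
  apply (is_derive_comp (fun y => sqrt (2 * y) ^ 3 / 3) u); [|exact Hu].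
  apply is_derive_sqrt_cube.
Qed.

Lemma energy_nonincreasing (k T a b : R) (u v : R -> R) :
  0 < k -> solves k sqrt_field T u v -> 0 <= a <= b -> b <= T ->
  energy (u b) (v b) <= energy (u a) (v a).
Proof.
intros Hk H Hab HbT.
apply (nonincreasing_on a b (fun s => energy (u s) (v s))
  (fun s => - k * v s ^ 2)); [lra| |].
- intros t Ht; apply (is_derive_energy k T); [exact H|lra].
- intros t Ht; nra.
Qed.

Lemma le_position_of_energy (u v e : R) : energy u v <= - e -> e <= u.
Proof.
unfold energy; intros H.
generalize (pow2_ge_0 v) (pow_le _ 3 (sqrt_pos (2 * u))); lra.
Qed.

Lemma energy_start (alpha : R) : 0 <= alpha ->
  energy (alpha ^ 2 / 2) 0 = alpha ^ 2 * (2 * alpha - 3) / 6.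
Proof.
intros H; unfold energy.
replace (2 * (alpha ^ 2 / 2)) with (alpha ^ 2) by field.
rewrite sqrt_pow2; [field|exact H].
Qed.

(** * Solutions starting at rest *)

Lemma derive_at_0_eps (f : R -> R) (l eps : R) : is_derive f 0 l -> 0 < eps ->
  exists del, 0 < del /\ forall t, 0 < t < del ->
    Rabs (f t - f 0 - l * t) < eps * t.
Proof.
intros Hd Heps; apply is_derive_Reals in Hd.
destruct (Hd eps Heps) as [del Hdel].
exists del; split; [apply cond_pos|].
intros t Ht.
generalize (Hdel t ltac:(lra) ltac:(rewrite Rabs_pos_eq; lra)).
rewrite Rplus_0_l; intros H.
replace (f t - f 0 - l * t) with (((f t - f 0) / t - l) * t) by (field; lra).
rewrite Rabs_mult (Rabs_pos_eq t); [|lra].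
apply Rmult_lt_compat_r; lra.
Qed.

(** For [alpha = 0] the velocity grows like [t], so that [u] grows like
    [t ^ 2 / 2] and clears the floor; for [alpha > 0] the position starts
    above it. *)
Lemma early_bounds (alpha : R) (u v : R -> R) :
  0 <= alpha ->
  u 0 = alpha ^ 2 / 2 -> v 0 = 0 ->
  (forall t, 0 <= t <= 1 -> is_derive u t (v t)) ->
  is_derive v 0 (1 - alpha) ->
  exists del, 0 < del <= 1 /\ forall t, 0 < t <= del ->
    t / 2 <= sqrt (2 * u t) /\ (alpha <> 1 -> v t <> 0).
Proof.
intros Ha Hu0 Hv0 Du Dv.
assert (A1 : exists d1, 0 < d1 /\ forall t, 0 < t < d1 -> alpha <> 1 -> v t <> 0).
{ destruct (Req_dec alpha 1) as [E|E]; [exists 1; split; [lra|intros; lra]|].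
  destruct (derive_at_0_eps v (1 - alpha) (Rabs (1 - alpha)) Dv)
    as [d1 [Hd1 H1]]; [apply Rabs_pos_lt; lra|].
  exists d1; split; [exact Hd1|]; intros t Ht _ Hvt.
  generalize (H1 t Ht); rewrite Hvt Hv0.
  replace (0 - 0 - (1 - alpha) * t) with (- ((1 - alpha) * t)) by ring.
  rewrite Rabs_Ropp Rabs_mult (Rabs_pos_eq t); lra. }
assert (A2 : exists d2, 0 < d2 <= 1 /\ forall t, 0 < t < d2 -> t ^ 2 / 4 <= 2 * u t).
{ destruct (Req_dec alpha 0) as [E|E].
  - subst alpha.
    destruct (derive_at_0_eps v (1 - 0) (1 / 2) Dv) as [d2 [Hd2 H2]]; [lra|].
    exists (Rmin 1 d2).
    assert (Hm1 : Rmin 1 d2 <= 1) by apply Rmin_l.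
    assert (Hm2 : Rmin 1 d2 <= d2) by apply Rmin_r.
    split; [split; [apply Rmin_glb_lt; lra|exact Hm1]|].
    intros t Ht.
    assert (H : t ^ 2 / 4 - u t <= 0 ^ 2 / 4 - u 0).
    { apply (nonincreasing_on 0 t (fun s => s ^ 2 / 4 - u s)
        (fun s => s / 2 - v s)); [lra| |].
      - intros s Hs; apply (is_derive_minus (fun s => s ^ 2 / 4) u).
        + auto_derive; [exact I|field].
        + apply Du; lra.
      - intros s Hs; generalize (H2 s ltac:(lra)); rewrite Hv0; intros H3.
        apply Rabs_def2 in H3; lra. }
    rewrite Hu0 in H; generalize (pow2_ge_0 t); lra.
  - destruct (continuous_eps u 0 (alpha ^ 2 / 4)) as [d2 [Hd2 H2]].
    + apply (ex_derive_continuous u); eexists; apply Du; lra.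
    + nra.
    + exists (Rmin (Rmin 1 alpha) d2).
      assert (Hm1 : Rmin (Rmin 1 alpha) d2 <= Rmin 1 alpha) by apply Rmin_l.
      assert (Hm2 : Rmin (Rmin 1 alpha) d2 <= d2) by apply Rmin_r.
      generalize (Rmin_l 1 alpha) (Rmin_r 1 alpha); intros Hm3 Hm4.
      split; [split; [repeat apply Rmin_glb_lt; lra|lra]|].
      intros t Ht.
      assert (H3 : Rabs (u t - u 0) < alpha ^ 2 / 4)
        by (apply H2; apply Rabs_def1; lra).
      apply Rabs_def2 in H3; rewrite Hu0 in H3; nra. }
destruct A1 as [d1 [Hd1 A1]]; destruct A2 as [d2 [Hd2 A2]].
assert (Hm : 0 < Rmin d1 d2) by (apply Rmin_glb_lt; lra).
generalize (Rmin_l d1 d2) (Rmin_r d1 d2); intros Hm1 Hm2.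
exists (Rmin d1 d2 / 2); split; [lra|].
intros t Ht; split; [|apply A1; lra].
rewrite -(sqrt_pow2 (t / 2)); [|lra].
apply sqrt_le_1_alt; generalize (A2 t ltac:(lra)); lra.
Qed.

(** Some energy is lost initially unless [alpha = 1], the equilibrium, whose
    energy is already negative. *)
Lemma early_energy (k alpha del : R) (u v : R -> R) :
  0 < k -> 0 <= alpha <= 3 / 2 -> 0 < del ->
  u 0 = alpha ^ 2 / 2 -> v 0 = 0 ->
  solves k sqrt_field del u v ->
  (forall t, 0 < t <= del -> alpha <> 1 -> v t <> 0) ->
  energy (u del) (v del) < 0.
Proof.
intros Hk Ha Hdel Hu0 Hv0 H Hne.
assert (E0 : energy (u 0) (v 0) = alpha ^ 2 * (2 * alpha - 3) / 6)
  by (rewrite Hu0 Hv0; apply energy_start; lra).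
destruct (Req_dec alpha 1) as [E|E].
- generalize (energy_nonincreasing k del 0 del u v Hk H ltac:(lra) ltac:(lra)).
  rewrite E0 E; lra.
- destruct (MVT_cor2 (fun s => energy (u s) (v s)) (fun s => - k * v s ^ 2) 0 del)
    as [c [Hc Hc']]; [lra| |].
  + intros t Ht; apply is_derive_Reals; now apply (is_derive_energy k del).
  + assert (0 < v c ^ 2) by (apply pow2_gt_0, Hne; [lra|exact E]).
    assert (alpha ^ 2 * (2 * alpha - 3) <= 0) by nra.
    assert (0 < k * v c ^ 2 * del) by (apply Rmult_lt_0_compat; nra).
    nra.
Qed.

Lemma solves_ext (k T : R) (g g' : R -> R -> R) (u v : R -> R) :
  (forall t, 0 <= t <= T -> g t (u t) = g' t (u t)) ->
  solves k g T u v -> solves k g' T u v.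
Proof. intros Hg H t Ht; rewrite -Hg; [|exact Ht]; now apply H. Qed.

Lemma trunc_field_eq (d t x : R) : Rmin t d / 2 <= sqrt (2 * x) ->
  trunc d t x = sqrt_field t x.
Proof. intros H; unfold trunc, sqrt_field; now apply Rmax_left. Qed.

(** Every solution starting at rest stays above a floor: the early bounds apply
    up to some time [del], and from then on [u >= - energy (u del) (v del)]. *)
Lemma solves_above_floor (k alpha : R) (u v : R -> R) :
  0 < k -> 0 <= alpha <= 3 / 2 ->
  u 0 = alpha ^ 2 / 2 -> v 0 = 0 ->
  (forall T, solves k sqrt_field T u v) ->
  exists d, 0 < d /\ forall t, 0 <= t -> Rmin t d / 2 <= sqrt (2 * u t).
Proof.
intros Hk Ha Hu0 Hv0 H.
destruct (early_bounds alpha u v) as [del [Hdel Hb]]; try tauto.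
{ intros t Ht; apply (H 1 t Ht). }
{ replace (1 - alpha) with (1 - k * v 0 - sqrt_field 0 (u 0)).
  - apply (H 0); lra.
  - unfold sqrt_field; rewrite Hv0 Hu0.
    replace (2 * (alpha ^ 2 / 2)) with (alpha ^ 2) by field.
    rewrite sqrt_pow2; lra. }
assert (He : energy (u del) (v del) < 0).
{ apply (early_energy k alpha); try tauto; [apply H|].
  intros t Ht; now apply Hb. }
set (eta := - energy (u del) (v del)).
assert (Heta : 0 < eta) by (unfold eta; lra).
assert (Hs : 0 < sqrt (2 * eta)) by (apply sqrt_lt_R0; lra).
exists (Rmin del (sqrt (2 * eta))); split; [apply Rmin_glb_lt; lra|].
intros t Ht.
destruct (Req_dec t 0) as [->|Ht0].
{ rewrite Rmin_left; [|apply Rmin_glb; lra].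
  unfold Rdiv; rewrite Rmult_0_l; apply sqrt_pos. }
destruct (Rle_dec t del) as [Htd|Htd].
- generalize (Rmin_l t (Rmin del (sqrt (2 * eta)))).
  generalize (proj1 (Hb t ltac:(lra))); lra.
- assert (eta <= u t).
  { apply (le_position_of_energy _ (v t)).
    generalize (energy_nonincreasing k t del t u v Hk (H t) ltac:(lra) ltac:(lra)).
    unfold eta; lra. }
  generalize (Rmin_r t (Rmin del (sqrt (2 * eta)))) (Rmin_r del (sqrt (2 * eta))).
  assert (sqrt (2 * eta) <= sqrt (2 * u t)) by (apply sqrt_le_1_alt; lra).
  lra.
Qed.

Lemma solves_unique (k alpha : R) (u1 v1 u2 v2 : R -> R) :
  0 < k -> 0 <= alpha <= 3 / 2 ->
  u1 0 = alpha ^ 2 / 2 -> v1 0 = 0 -> (forall T, solves k sqrt_field T u1 v1) ->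
  u2 0 = alpha ^ 2 / 2 -> v2 0 = 0 -> (forall T, solves k sqrt_field T u2 v2) ->
  forall t, 0 <= t -> u1 t = u2 t /\ v1 t = v2 t.
Proof.
intros Hk Ha Hu1 Hv1 H1 Hu2 Hv2 H2 t Ht.
destruct (solves_above_floor k alpha u1 v1) as [d1 [Hd1 F1]]; try assumption.
destruct (solves_above_floor k alpha u2 v2) as [d2 [Hd2 F2]]; try assumption.
assert (Hd : 0 < Rmin d1 d2) by (apply Rmin_glb_lt; lra).
apply (solves_trunc_unique k (Rmin d1 d2) t); try congruence; try lra.
- apply (solves_ext k t sqrt_field); [|apply H1].
  intros s Hs; symmetry; apply trunc_field_eq.
  eapply Rle_trans; [|apply F1; lra].
  generalize (Rle_min_compat_l _ _ s (Rmin_l d1 d2)); lra.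
- apply (solves_ext k t sqrt_field); [|apply H2].
  intros s Hs; symmetry; apply trunc_field_eq.
  eapply Rle_trans; [|apply F2; lra].
  generalize (Rle_min_compat_l _ _ s (Rmin_r d1 d2)); lra.
Qed.

Lemma solves_exists (k alpha : R) : 0 < k -> 0 <= alpha <= 3 / 2 ->
  exists u v, u 0 = alpha ^ 2 / 2 /\ v 0 = 0 /\
    forall T, solves k sqrt_field T u v.
Proof.
intros Hk Ha.
(* A first truncation yields the solution on [0, del] and its energy there. *)
destruct (solves_trunc_exists k 1 (alpha ^ 2 / 2) Hk Rlt_0_1)
  as [u1 [v1 [Hu1 [Hv1 H1]]]].
assert (Hroot : sqrt (2 * (alpha ^ 2 / 2)) = alpha).
{ replace (2 * (alpha ^ 2 / 2)) with (alpha ^ 2) by field.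
  apply sqrt_pow2; lra. }
destruct (early_bounds alpha u1 v1) as [del [Hdel Hb]]; try tauto.
{ intros t Ht; apply (H1 1 t Ht). }
{ replace (1 - alpha) with (1 - k * v1 0 - trunc 1 0 (u1 0)).
  - apply (H1 0); lra.
  - unfold trunc; rewrite Hv1 Hu1 Hroot Rmin_left; [|lra].
    rewrite Rmax_left; lra. }
assert (Hbd : forall d t, 0 <= t <= del -> Rmin t d / 2 <= sqrt (2 * u1 t)).
{ intros d t Ht; generalize (Rmin_l t d); intros Hm.
  destruct (Req_dec t 0) as [E|E].
  - generalize (sqrt_pos (2 * u1 t)); lra.
  - generalize (proj1 (Hb t ltac:(lra))); lra. }
assert (S1 : solves k sqrt_field del u1 v1).
{ apply (solves_ext k del (trunc 1)); [|apply H1].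
  intros t Ht; now apply trunc_field_eq, Hbd. }
assert (He : energy (u1 del) (v1 del) < 0).
{ apply (early_energy k alpha); try tauto; intros t Ht; now apply Hb. }
set (eta := - energy (u1 del) (v1 del)).
assert (Heta : 0 < eta) by (unfold eta; lra).
assert (Hs : 0 < sqrt (2 * eta)) by (apply sqrt_lt_R0; lra).
(* A second one, with a floor low enough for the energy to keep [u] above. *)
set (d := Rmin del (sqrt (2 * eta))).
assert (Hd : 0 < d) by (apply Rmin_glb_lt; lra).
assert (Hdd : d <= del) by apply Rmin_l.
assert (Hds : d <= sqrt (2 * eta)) by apply Rmin_r.
destruct (solves_trunc_exists k d (alpha ^ 2 / 2) Hk Hd)
  as [u2 [v2 [Hu2 [Hv2 H2]]]].
assert (Heq : forall t, 0 <= t <= del -> u2 t = u1 t /\ v2 t = v1 t).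
{ apply (solves_trunc_unique k d del); try congruence; try apply H2.
  apply (solves_ext k del sqrt_field); [|exact S1].
  intros t Ht; symmetry; now apply trunc_field_eq, Hbd. }
assert (Hearly : forall t, 0 <= t <= del -> Rmin t d / 2 <= sqrt (2 * u2 t)).
{ intros t Ht; rewrite (proj1 (Heq t Ht)); now apply Hbd. }
assert (Heta2 : sqrt (2 * eta) ^ 2 = 2 * eta) by (apply pow2_sqrt; lra).
assert (Habove : forall x, d ^ 2 / 8 <= x -> d / 2 <= sqrt (2 * x)).
{ intros x Hx; rewrite -(sqrt_pow2 (d / 2)); [|lra].
  apply sqrt_le_1_alt; lra. }
assert (Henergy : forall t, del <= t ->
  (forall s, del <= s <= t -> d ^ 2 / 8 <= u2 s) -> eta <= u2 t).
{ intros t Ht Hlow.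
  assert (S2 : solves k sqrt_field t u2 v2).
  { apply (solves_ext k t (trunc d)); [|apply H2].
    intros s Hs1; apply trunc_field_eq.
    destruct (Rle_dec s del) as [Hsd|Hsd]; [apply Hearly; lra|].
    generalize (Habove _ (Hlow s ltac:(lra))) (Rmin_r s d); lra. }
  apply (le_position_of_energy _ (v2 t)).
  generalize (energy_nonincreasing k t del t u2 v2 Hk S2 ltac:(lra) ltac:(lra)).
  rewrite (proj1 (Heq del ltac:(lra))) (proj2 (Heq del ltac:(lra))).
  unfold eta; lra. }
assert (Hgap : d ^ 2 / 8 < eta).
{ assert (d ^ 2 <= sqrt (2 * eta) ^ 2) by (apply pow_incr; lra). lra. }
assert (Hlate : forall t, del <= t -> d ^ 2 / 8 < u2 t).
{ intros t Ht.
  apply (interval_induction del t); [| | |lra].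
  - intros s Hs1; apply (ex_derive_continuous u2).
    eexists; apply (H2 s); lra.
  - intros s Hs1 Hbelow Hm.
    eapply Rlt_le_trans; [exact Hgap|apply Henergy; [lra|]].
    intros r Hr; destruct (Req_dec r s) as [->|E]; [exact Hm|].
    apply Rlt_le, Hbelow; lra.
  - eapply Rlt_le_trans; [exact Hgap|].
    rewrite (proj1 (Heq del ltac:(lra))).
    apply (le_position_of_energy _ (v1 del)); unfold eta; lra. }
exists u2, v2; split; [exact Hu2|split; [exact Hv2|]].
intros T; apply (solves_ext k T (trunc d)); [|apply H2].
intros t Ht; apply trunc_field_eq.
destruct (Rle_dec t del) as [H|H]; [apply Hearly; lra|].
generalize (Habove _ (Rlt_le _ _ (Hlate t ltac:(lra)))) (Rmin_r t d); lra.
Qed.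

(** * Exponential decay to the equilibrium *)

(** [H u - H (1 / 2)] is comparable to [(u - 1 / 2) ^ 2], and the restoring force
    is coercive, as long as [r = sqrt (2 * u)] is at most [3 / 2]. *)
Lemma potential_bounds (r : R) : 0 <= r <= 3 / 2 ->
  (r ^ 2 / 2 - 1 / 2) ^ 2 * (2 / 5) <= r ^ 3 / 3 - r ^ 2 / 2 + 1 / 6 /\
  r ^ 3 / 3 - r ^ 2 / 2 + 1 / 6 <= (r ^ 2 / 2 - 1 / 2) ^ 2 * (2 / 3) /\
  (r ^ 2 / 2 - 1 / 2) ^ 2 * (4 / 5) <= (r ^ 2 / 2 - 1 / 2) * (r - 1).
Proof.
intros Hr.
assert (Hsq : 0 <= (r - 1) ^ 2) by apply pow2_ge_0.
(* Each difference is [(r - 1) ^ 2] times a nonnegative factor. *)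
split; [|split]; apply Rminus_le_0.
- replace (_ - _) with ((r - 1) ^ 2 * ((2 * r + 1) / 6 - (r + 1) ^ 2 / 10))
    by field.
  apply Rmult_le_pos; [exact Hsq|nra].
- replace (_ - _) with ((r - 1) ^ 2 * (r ^ 2 / 6)) by field.
  apply Rmult_le_pos; [exact Hsq|nra].
- replace (_ - _) with ((r - 1) ^ 2 * ((r + 1) * (3 / 2 - r) / 5)) by field.
  apply Rmult_le_pos; [exact Hsq|].
  assert (0 <= (r + 1) * (3 / 2 - r)) by (apply Rmult_le_pos; lra). lra.
Qed.

(** The shifted energy with a cross term, which makes its decay strict. *)
Definition lyapunov (eps u v : R) : R :=
  energy u v + 1 / 6 + eps * (v * (u - 1 / 2)).

Lemma is_derive_lyapunov (k eps T t : R) (u v : R -> R) :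
  solves k sqrt_field T u v -> 0 <= t <= T ->
  is_derive (fun s => lyapunov eps (u s) (v s)) t
    (- k * v t ^ 2 + eps * ((1 - k * v t - sqrt (2 * u t)) * (u t - 1 / 2)
      + v t ^ 2)).
Proof.
intros H Ht; generalize (is_derive_energy k T t u v H Ht); intros He.
destruct (H t Ht) as [Hu Hv]; unfold sqrt_field in Hv; unfold lyapunov.
apply (is_derive_plus (fun s => energy (u s) (v s) + 1 / 6)
  (fun s => eps * (v s * (u s - 1 / 2)))).
- rewrite -(Rplus_0_r (- k * v t ^ 2)).
  apply (is_derive_plus (fun s => energy (u s) (v s)) (fun _ => 1 / 6)).
  + exact He.
  + apply (@is_derive_const R_AbsRing R_NormedModule).
- auto_derive; [repeat split; eexists; eassumption|].
  rewrite (is_derive_unique _ _ _ Hv) (is_derive_unique _ _ _ Hu); ring.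
Qed.

Lemma sqrt_le_of_energy (u v : R) : 0 <= u -> energy u v <= 0 ->
  sqrt (2 * u) <= 3 / 2.
Proof.
unfold energy; intros Hu H.
generalize (sqrt_pos (2 * u)) (sqrt_sqrt (2 * u) ltac:(lra)) (pow2_ge_0 v).
set (r := sqrt (2 * u)) in *; intros Hr Hrr Hv.
apply Rnot_lt_le; intros Hlt.
assert (0 < r ^ 2 * (2 * r - 3)) by (apply Rmult_lt_0_compat; nra).
nra.
Qed.

Lemma lyapunov_bounds (eps u v : R) : 0 <= eps <= 1 / 4 -> 0 <= u ->
  energy u v <= 0 ->
  ((u - 1 / 2) ^ 2 + v ^ 2) / 8 <= lyapunov eps u v <= (u - 1 / 2) ^ 2 + v ^ 2.
Proof.
intros Heps Hu He.
generalize (sqrt_le_of_energy u v Hu He) (sqrt_pos (2 * u)); intros Hr1 Hr0.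
destruct (potential_bounds (sqrt (2 * u))) as [B1 [B2 _]]; [lra|].
rewrite (pow2_sqrt (2 * u)) in B1, B2; try lra.
replace (2 * u / 2) with u in B1, B2 by field.
unfold lyapunov, energy.
set (x := u - 1 / 2) in *.
assert (C1 : Rabs (v * x) <= (x ^ 2 + v ^ 2) / 2).
{ apply Rabs_le; generalize (pow2_ge_0 (x - v)) (pow2_ge_0 (x + v)); lra. }
assert (C2 : Rabs (eps * (v * x)) <= (x ^ 2 + v ^ 2) / 8).
{ rewrite Rabs_mult (Rabs_pos_eq eps); [|lra].
  generalize (Rabs_pos (v * x)); nra. }
generalize (Rle_abs (eps * (v * x))) (Rle_abs (- (eps * (v * x)))).
rewrite Rabs_Ropp.
generalize (pow2_ge_0 x) (pow2_ge_0 v); lra.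
Qed.

Lemma lyapunov_dissipation (k eps u v : R) :
  0 < k -> 0 <= eps -> eps * (1 + k ^ 2) <= k / 2 -> eps <= 1 / 4 -> 0 <= u ->
  energy u v <= 0 ->
  - k * v ^ 2 + eps * ((1 - k * v - sqrt (2 * u)) * (u - 1 / 2) + v ^ 2)
    <= - (2 * eps / 5) * lyapunov eps u v.
Proof.
intros Hk Heps0 Heps1 Heps2 Hu He.
destruct (lyapunov_bounds eps u v ltac:(lra) Hu He) as [_ HV].
generalize (sqrt_le_of_energy u v Hu He) (sqrt_pos (2 * u)); intros Hr1 Hr0.
destruct (potential_bounds (sqrt (2 * u))) as [_ [_ B3]]; [lra|].
rewrite (pow2_sqrt (2 * u)) in B3; [|lra].
replace (2 * u / 2) with u in B3 by field.
set (x := u - 1 / 2) in *; set (r := sqrt (2 * u)) in *.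
assert (C1 : - (k * v * x) <= 2 / 5 * x ^ 2 + 5 / 8 * (k * v) ^ 2).
{ generalize (pow2_ge_0 (2 / 5 * x + 1 / 2 * (k * v)))
    (pow2_ge_0 (k * v)); lra. }
apply Rle_trans with (- (2 * eps / 5) * (x ^ 2 + v ^ 2)); [|nra].
assert (C2 : (1 - k * v - r) * x + v ^ 2
  <= - (2 / 5) * x ^ 2 + (1 + 5 / 8 * k ^ 2) * v ^ 2) by nra.
assert (C3 : eps * ((1 - k * v - r) * x + v ^ 2)
  <= eps * (- (2 / 5) * x ^ 2 + (1 + 5 / 8 * k ^ 2) * v ^ 2))
  by (apply Rmult_le_compat_l; lra).
assert (C4 : 0 <= (k - eps * (7 / 5 + 5 / 8 * k ^ 2)) * v ^ 2).
{ apply Rmult_le_pos; [|apply pow2_ge_0].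
  assert (0 <= eps * k ^ 2) by (apply Rmult_le_pos; [lra|apply pow2_ge_0]).
  lra. }
lra.
Qed.

Lemma exponential_decay (k : R) (u v : R -> R) : 0 < k ->
  energy (u 0) (v 0) <= 0 -> (forall T, solves k sqrt_field T u v) ->
  exists C mu, 0 <= C /\ 0 < mu /\ forall t, 0 <= t ->
    (u t - 1 / 2) ^ 2 + v t ^ 2 <= C * exp (- (mu * t)).
Proof.
intros Hk H0 H.
assert (He : forall t, 0 <= t -> energy (u t) (v t) <= 0).
{ intros t Ht.
  generalize (energy_nonincreasing k t 0 t u v Hk (H t) ltac:(lra) ltac:(lra)).
  lra. }
assert (Hu : forall t, 0 <= t -> 0 <= u t).
{ intros t Ht; apply (le_position_of_energy _ (v t)).
  rewrite Ropp_0; now apply He. }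
assert (Hk2 : 0 < 1 + k ^ 2) by nra.
set (eps := k / (2 * (1 + k ^ 2))).
assert (Heps : eps * (1 + k ^ 2) = k / 2) by (unfold eps; field; nra).
assert (Heps0 : 0 < eps) by (apply Rdiv_lt_0_compat; lra).
assert (Heps1 : eps <= 1 / 4).
{ apply (Rmult_le_reg_r (1 + k ^ 2)); [exact Hk2|].
  rewrite Heps; generalize (pow2_ge_0 (k - 1)); lra. }
set (mu := 2 * eps / 5).
assert (Hmu : 0 < mu) by (unfold mu; lra).
set (L := fun s => lyapunov eps (u s) (v s)).
assert (HL : forall t, 0 <= t -> ((u t - 1 / 2) ^ 2 + v t ^ 2) / 8 <= L t).
{ intros t Ht; apply lyapunov_bounds; [lra|now apply Hu|now apply He]. }
exists (8 * L 0), mu; split; [|split; [exact Hmu|]].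
{ generalize (HL 0 ltac:(lra)) (pow2_ge_0 (u 0 - 1 / 2)) (pow2_ge_0 (v 0)); lra. }
intros t Ht.
assert (Hdecay : L t * exp (mu * t) <= L 0 * exp (mu * 0)).
{ apply (nonincreasing_on 0 t (fun s => L s * exp (mu * s))
    (fun s => (- k * v s ^ 2 + eps * ((1 - k * v s - sqrt (2 * u s))
      * (u s - 1 / 2) + v s ^ 2)) * exp (mu * s) + L s * (mu * exp (mu * s))));
    [exact Ht| |].
  - intros s Hs.
    apply (is_derive_mult (K := R_AbsRing) L (fun s => exp (mu * s))).
    + now apply (is_derive_lyapunov k eps t).
    + auto_derive; [exact I|ring].
    + intros; apply Rmult_comm.
  - intros s Hs.
    generalize (lyapunov_dissipation k eps (u s) (v s) Hk ltac:(lra) ltac:(lra)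
      Heps1 (Hu s ltac:(lra)) (He s ltac:(lra))).
    fold mu; change (lyapunov eps (u s) (v s)) with (L s).
    generalize (exp_pos (mu * s)); nra. }
rewrite Rmult_0_r exp_0 in Hdecay.
rewrite exp_Ropp; apply (Rmult_le_reg_r (exp (mu * t))); [apply exp_pos|].
rewrite Rmult_assoc Rinv_l; [|generalize (exp_pos (mu * t)); lra].
generalize (HL t Ht) (exp_pos (mu * t)); nra.
Qed.

Lemma exponential_decay_lim (C mu : R) (u v : R -> R) :
  0 <= C -> 0 < mu ->
  (forall t, 0 <= t -> (u t - 1 / 2) ^ 2 + v t ^ 2 <= C * exp (- (mu * t))) ->
  filterlim (fun t => (u t, v t)) (Rbar_locally p_infty)
    (locally ((1 / 2, 0) : R * R)).
Proof.
intros HC Hmu H.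
apply filterlim_locally; intros eps.
generalize (cond_pos eps); intros Heps.
(* Beyond this time, [C * exp (- (mu * t)) <= C / (1 + mu * t) < eps ^ 2]. *)
exists (C / (eps ^ 2 * mu)); intros t Ht.
assert (He2 : 0 < eps ^ 2 * mu) by (apply Rmult_lt_0_compat; nra).
assert (HC' : C < t * (eps ^ 2 * mu)).
{ apply (Rmult_lt_compat_r (eps ^ 2 * mu)) in Ht; [|exact He2].
  replace (C / (eps ^ 2 * mu) * (eps ^ 2 * mu)) with C in Ht; [exact Ht|].
  field; split; lra. }
assert (Ht0 : 0 <= t) by nra.
assert (Hsmall : C * exp (- (mu * t)) < eps ^ 2).
{ rewrite exp_Ropp.
  apply (Rmult_lt_reg_r (exp (mu * t))); [apply exp_pos|].
  rewrite Rmult_assoc Rinv_l; [|generalize (exp_pos (mu * t)); lra].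
  generalize (exp_ineq1_le (mu * t)); nra. }
generalize (H t Ht0) (pow2_ge_0 (u t - 1 / 2)) (pow2_ge_0 (v t)); intros H1 H2 H3.
split.
- change (Rabs (u t - 1 / 2) < eps).
  rewrite -(Rabs_pos_eq eps); [|lra].
  apply Rsqr_lt_abs_0; rewrite !Rsqr_pow2; lra.
- change (Rabs (v t - 0) < eps).
  rewrite Rminus_0_r -(Rabs_pos_eq eps); [|lra].
  apply Rsqr_lt_abs_0; rewrite !Rsqr_pow2; lra.
Qed.

(** * One-sided derivatives at the initial time *)

(** Linear continuation of a function on [[0, oo)] to negative times, with slope
    [l]. *)
Definition linear_extension (f : R -> R) (l t : R) : R :=
  match Rle_dec 0 t with left _ => f t | right _ => f 0 + l * t end.

Lemma linear_extension_eq (f : R -> R) (l t : R) : 0 <= t ->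
  linear_extension f l t = f t.
Proof. intros Ht; unfold linear_extension; destruct Rle_dec; [reflexivity|lra]. Qed.

Lemma is_derive_linear_extension (f f' : R -> R) (t : R) : 0 <= t ->
  D_in f f' (fun s => 0 <= s) t ->
  is_derive (linear_extension f (f' 0)) t (f' t).
Proof.
intros Ht Hd; apply is_derive_Reals; intros eps Heps.
destruct (Hd eps Heps) as [del [Hdel Hlim]].
assert (Hin : forall h, h <> 0 -> 0 <= t + h -> Rabs h < del ->
  Rabs ((linear_extension f (f' 0) (t + h) - linear_extension f (f' 0) t) / h
    - f' t) < eps).
{ intros h Hh0 Hth Hh; rewrite !linear_extension_eq; try lra.
  generalize (Hlim (t + h)); simpl; unfold Rdist.
  replace (t + h - t) with h by ring; intros H; apply H.
  split; [split; [exact Hth|lra]|exact Hh]. }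
destruct (Req_dec t 0) as [->|Hne].
- exists (mkposreal del Hdel); intros h Hh0 Hh; simpl in Hh.
  destruct (Rle_dec 0 h) as [H|H]; [apply Hin; lra|].
  rewrite Rplus_0_l; unfold linear_extension.
  destruct (Rle_dec 0 h); [lra|]; destruct (Rle_dec 0 0); [|lra].
  replace (_ - f' 0) with 0 by (field; lra).
  rewrite Rabs_R0; exact Heps.
- assert (Hm : 0 < Rmin del t) by (apply Rmin_glb_lt; lra).
  exists (mkposreal _ Hm); intros h Hh0 Hh; simpl in Hh.
  generalize (Rmin_l del t) (Rmin_r del t); intros H1 H2.
  apply Hin; [exact Hh0| |lra].
  apply Rabs_def2 in Hh; lra.
Qed.

Lemma D_in_of_is_derive (f f' : R -> R) (D : R -> Prop) (t : R) :
  is_derive f t (f' t) -> D_in f f' D t.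
Proof.
intros Hd eps Heps; apply is_derive_Reals in Hd.
destruct (Hd eps Heps) as [del Hdel].
exists del; split; [apply cond_pos|].
intros s [[_ Hne] Hs]; simpl in *; unfold Rdist in *.
generalize (Hdel (s - t) ltac:(lra) Hs).
replace (t + (s - t)) with s by ring; tauto.
Qed.

Lemma is_solution_of_solves (beta omega : R) (p0 : R * R) (u v : R -> R) :
  (u 0, v 0) = p0 ->
  (forall t, 0 <= t -> 0 <= u t) ->
  (forall T, solves (beta / sqrt omega) sqrt_field T u v) ->
  is_solution beta omega p0 u v.
Proof.
intros H0 Hu H; split; [exact H0|]; intros t Ht.
destruct (H t t ltac:(lra)) as [Du Dv].
split; [now apply Hu|split; apply D_in_of_is_derive; assumption].
Qed.

Lemma solves_of_is_solution (beta omega : R) (p0 : R * R) (u v : R -> R) :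
  is_solution beta omega p0 u v ->
  exists u' v' : R -> R, (forall t, 0 <= t -> u' t = u t /\ v' t = v t) /\
    forall T, solves (beta / sqrt omega) sqrt_field T u' v'.
Proof.
intros [_ H].
set (a := v 0); set (b := 1 - beta / sqrt omega * v 0 - sqrt (2 * u 0)).
exists (linear_extension u a), (linear_extension v b).
split; [intros; split; now apply linear_extension_eq|].
intros T t [Ht _]; destruct (H t Ht) as [_ [Du Dv]].
rewrite !linear_extension_eq; [|exact Ht|exact Ht].
split.
- exact (is_derive_linear_extension u _ t Ht Du).
- exact (is_derive_linear_extension v _ t Ht Dv).
Qed.

Lemma critical_point_unique (beta omega : R) :
  unique (critical_point beta omega) (1 / 2, 0).
Proof.
split.
- split; simpl; [lra|].
  unfold vector_field; simpl.
  replace (2 * (1 / 2)) with 1 by field; rewrite sqrt_1.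
  f_equal; ring.
- intros [x y] [Hx H]; simpl in Hx; unfold vector_field in H; simpl in H.
  injection H as Hy Hs; subst y.
  assert (Hr : sqrt (2 * x) = 1) by lra.
  generalize (sqrt_sqrt (2 * x) ltac:(lra)); rewrite Hr; intros H2.
  f_equal; lra.
Qed.

Theorem corollary5p5 (beta omega alpha : R)
    (hbeta : 0 < beta) (homega : 0 < omega) (halpha : 0 <= alpha <= 3 / 2) :
  unique (critical_point beta omega) (1 / 2, 0) /\
  exists u v : R -> R,
    is_solution beta omega (alpha ^ 2 / 2, 0) u v /\
    (forall u1 v1 : R -> R,
       is_solution beta omega (alpha ^ 2 / 2, 0) u1 v1 ->
       forall t : R, 0 <= t -> u1 t = u t /\ v1 t = v t) /\
    filterlim (fun t : R => (u t, v t)) (Rbar_locally p_infty)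
      (locally ((1 / 2, 0) : R * R)).
Proof.
split; [apply critical_point_unique|].
set (k := beta / sqrt omega).
assert (Hk : 0 < k) by (apply Rdiv_lt_0_compat; [lra|now apply sqrt_lt_R0]).
destruct (solves_exists k alpha Hk halpha) as [u [v [Hu0 [Hv0 H]]]].
assert (He : energy (u 0) (v 0) <= 0).
{ rewrite Hu0 Hv0 energy_start; [|lra].
  generalize (pow2_ge_0 alpha); nra. }
exists u, v; split; [|split].
- apply is_solution_of_solves; [congruence| |exact H].
  intros t Ht; apply (le_position_of_energy _ (v t)).
  generalize (energy_nonincreasing k t 0 t u v Hk (H t) ltac:(lra) ltac:(lra)).
  lra.
- intros u1 v1 H1 t Ht.
  destruct (solves_of_is_solution _ _ _ _ _ H1) as [u' [v' [Heq H']]].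
  destruct (Heq t Ht) as [<- <-].
  destruct (Heq 0 ltac:(lra)) as [Hu' Hv'].
  destruct H1 as [H0 _]; injection H0 as Hu1 Hv1.
  apply (solves_unique k alpha); try assumption; [now rewrite Hu'|now rewrite Hv'].
- destruct (exponential_decay k u v Hk He H) as [C [mu [HC [Hmu Hdec]]]].
  exact (exponential_decay_lim C mu u v HC Hmu Hdec).
Qed.
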